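(* Let $\Omega$ be a nc subset of $\mathcal S_{\rm nc}$ where $\mathcal S$ is a set, $\mathcal A$ a unital $C^*$-algebra, $\mathcal H$ a Hilbert space equipped with a unital $*$-representation $\sigma_{\mathcal H}\colon\mathcal A\to\mathcal L(\mathcal H)$, $\mathcal Y$ a Hilbert space, and $H\colon\Omega\to\mathcal L(\mathcal H,\mathcal Y)_{\rm nc}$ a global function. For $h\in\mathcal H$ define $f_h\colon\Omega\to\mathcal L(\mathcal A,\mathcal Y)_{\rm nc}$ by $$f_h(Z)u=H(Z)\,(\mathrm{id}_{\mathbb C^n}\otimes\sigma_{\mathcal H})(u)\,h,\qquad Z\in\Omega_n,\ u\in\mathcal A^n,$$ and let $$\mathcal H_\ell=\{f\colon\Omega\to\mathcal L(\mathcal A,\mathcal Y)_{\rm nc}\colon f=f_h\text{ for some }h\in\mathcal H\},\qquad \|f\|^2_{\mathcal H_\ell}=\min\{\|h\|^2\colon h\in\mathcal H,\ f=f_h\}.$$ Then $\mathcal H_\ell$ is a global reproducing kernel Hilbert space with reproducing kernel $K$ given by $$K(Z,W)(P)=H(Z)\,(\mathrm{id}_{\mathbb C^{n\times m}}\otimes\sigma_{\mathcal H})(P)\,H(W)^*$$ for $Z\in\Omega_n$, $W\in\Omega_m$, $P\in\mathcal A^{n\times m}$ (that is, $K$ is a cp global kernel and $\mathcal H_\ell=\mathcal H(K)$ isometrically). If $\mathcal S$ is taken to be a complex vector space $\mathcal V$ and $H$ is assumed to be a nc function, then $K$ is a cp nc kernel.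
   Context: For a set $\mathcal S$, $\mathcal S_{\rm nc}=\coprod_{n\ge1}\mathcal S^{n\times n}$. For $\Omega\subset\mathcal S_{\rm nc}$ put $\Omega_n=\Omega\cap\mathcal S^{n\times n}$. $\Omega$ is a nc set if it is closed under direct sums $(Z,W)\mapsto\begin{bmatrix}Z&0\\0&W\end{bmatrix}$ (zero blocks formal if $\mathcal S$ is a bare set). $\mathcal L(\mathcal X,\mathcal Y)$ denotes bounded linear operators and $\mathcal L(\mathcal X,\mathcal Y)^{n\times n}\cong\mathcal L(\mathcal X^n,\mathcal Y^n)$. A function $f\colon\Omega\to\mathcal L(\mathcal X,\mathcal Y)_{\rm nc}$ is a global function if it is graded ($f(Z)\in\mathcal L(\mathcal X,\mathcal Y)^{n\times n}$ for $Z\in\Omega_n$) and respects direct sums: $f\left(\begin{bmatrix}Z&0\\0&W\end{bmatrix}\right)=\begin{bmatrix}f(Z)&0\\0&f(W)\end{bmatrix}$. If $\Omega\subset\mathcal V_{\rm nc}$ with $\mathcal V$ a complex vector space, $f$ is a nc function if it is graded and $Z\in\Omega_n$, $\widetilde Z\in\Omega_m$, $\alpha\in\mathbb C^{m\times n}$, $\alpha Z=\widetilde Z\alpha$ imply $\alpha f(Z)=f(\widetilde Z)\alpha$. A function $K\colon\Omega\times\Omega\to\mathcal L(\mathcal A,\mathcal L(\mathcal Y))_{\rm nc}$ is graded if for $Z\in\Omega_n$, $W\in\Omega_m$, $K(Z,W)$ is a linear map $\mathcal A^{n\times m}\to\mathcal L(\mathcal Y)^{n\times m}\cong\mathcal L(\mathcal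 Y^m,\mathcal Y^n)$. It is a global kernel if it is graded and $$K\left(\begin{bmatrix}Z&0\\ 0&\widetilde Z\end{bmatrix},\begin{bmatrix}W&0\\ 0&\widetilde W\end{bmatrix}\right)\left(\begin{bmatrix}P_{11}&P_{12}\\ P_{21}&P_{22}\end{bmatrix}\right)=\begin{bmatrix}K(Z,W)(P_{11})&K(Z,\widetilde W)(P_{12})\\ K(\widetilde Z,W)(P_{21})&K(\widetilde Z,\widetilde W)(P_{22})\end{bmatrix}.$$ If $\Omega\subset\mathcal V_{\rm nc}$, $K$ is a nc kernel if it is graded and: $\alpha Z=\widetilde Z\alpha$, $\beta W=\widetilde W\beta$ ($Z\in\Omega_n$, $\widetilde Z\in\Omega_{\tilde n}$, $W\in\Omega_m$, $\widetilde W\in\Omega_{\tilde m}$, $\alpha\in\mathbb C^{\tilde n\times n}$, $\beta\in\mathbb C^{\tilde m\times m}$), $P\in\mathcal A^{n\times m}$ imply $\alpha K(Z,W)(P)\beta^*=K(\widetilde Z,\widetilde W)(\alpha P\beta^* )$. A global/nc kernel is cp if $K(Z,Z)(P)\succeq0$ whenever $Z\in\Omega_n$, $P\succeq0$ in $\mathcal A^{n\times n}$, $n\in\mathbb N$. $\mathcal A^n$ denotes columns, $\mathcal A^{1\times m}$ rows over $\mathcal A$; $v^*$ is the conjugate transpose; $\mathrm{id}\otimes\sigma$ is $\sigma$ applied entrywise. For a cp global (nc) kernel $K$, the global (nc) reproducing kernel Hilbert space $\mathcal H(K)$ is the unique Hilbert space of global (nc) functions $f\colon\Omega\to\mathcal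 L(\mathcal A,\mathcal Y)_{\rm nc}$ such that: (a) for $W\in\Omega_m$, $v\in\mathcal A^{1\times m}$, $y\in\mathcal Y^m$ the function $K_{W,v,y}(Z)u=K(Z,W)(uv)y$ ($Z\in\Omega_n$, $u\in\mathcal A^n$) belongs to $\mathcal H(K)$; (b) $\langle f(W)(v^* ),y\rangle_{\mathcal Y^m}=\langle f,K_{W,v,y}\rangle_{\mathcal H(K)}$ for all $f\in\mathcal H(K)$; (c) $(\sigma(a)f)(W)(v^* )=f(W)(v^*a)$ defines a unital $*$-representation $\sigma$ of $\mathcal A$ on $\mathcal H(K)$, with $\sigma(a)K_{W,v,y}=K_{W,av,y}$. *)

(* Defs.v *)
From HB Require Import structures.
From mathcomp Require Import all_boot all_order all_algebra.
From mathcomp Require Import spectral sesquilinear.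
From mathcomp Require Import all_classical all_reals topology normedtype.
From mathcomp Require Export complex.

Set Implicit Arguments.
Unset Strict Implicit.
Unset Printing Implicit Defensive.

Import Order.TTheory GRing.Theory Num.Theory Num.Def.
Import numFieldNormedType.Exports.

Local Open Scope classical_set_scope.
Local Open Scope ring_scope.

(* The inner product is linear in its first argument and conjugate linear in
   the second one; the norm takes its values in the nonnegative reals of
   R[i]. *)
HB.mixin Record isHilbert (R : realType) V
    & CompleteNormedModule R[i] V := {
  inner : {dot V for @conjC R[i]};
  sqr_norm_inner : forall x : V, `|x| ^+ 2 = inner x x
}.

#[short(type="hilbertType")]
HB.structure Definition Hilbert (R : realType) :=
  {V of CompleteNormedModule R[i] V & isHilbert R V}.

(* Hierarchy Builder does not accept a join of rings and normed modules, since
   it would compete with numDomainType; the product is therefore a field of the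
   mixin, and the ring structure is added afterwards.  A pzRingType, unlike a
   nzRingType, may be the zero ring. *)
HB.mixin Record isCStarAlgebra (R : realType) A
    & CompleteNormedModule R[i] A := {
  cstar_one : A;
  cstar_mul : A -> A -> A;
  cstar_mulA : associative cstar_mul;
  cstar_mul1 : left_id cstar_one cstar_mul;
  cstar_mulr1 : right_id cstar_one cstar_mul;
  cstar_mulDl : left_distributive cstar_mul +%R;
  cstar_mulDr : right_distributive cstar_mul +%R;
  cstar_scaleAl : forall (c : R[i]) (a b : A),
    c *: cstar_mul a b = cstar_mul (c *: a) b;
  cstar_scaleAr : forall (c : R[i]) (a b : A),
    c *: cstar_mul a b = cstar_mul a (c *: b);
  cstar_normM : forall a b : A, `|cstar_mul a b| <= `|a| * `|b|;
  star : A -> A;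
  starK : involutive star;
  starD : {morph star : a b / a + b};
  starZ : forall (c : R[i]) (a : A), star (c *: a) = c^* *: star a;
  starM : forall a b : A, star (cstar_mul a b) = cstar_mul (star b) (star a);
  cstar_norm : forall a : A, `|cstar_mul (star a) a| = `|a| ^+ 2
}.

#[short(type="cstarAlgType")]
HB.structure Definition CStarAlgebra (R : realType) :=
  {A of CompleteNormedModule R[i] A & isCStarAlgebra R A}.

#[non_forgetful_inheritance]
HB.instance Definition _ (R : realType) (A : cstarAlgType R) :=
  GRing.Zmodule_isPzRing.Build A cstar_mulA cstar_mul1 cstar_mulr1
    cstar_mulDl cstar_mulDr.

Section Operators.
Variable R : realType.
Local Notation C := R[i].

(* L(X, Y) is rendered as a predicate on functions X -> Y, so that
   L(X, Y)^{n x m} consists of the T : 'M[X -> Y]_(n, m) with entries in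
   L(X, Y). *)
Definition bounded_op (X Y : normedModType C) (T : X -> Y) :=
  linear T /\ exists c : C, forall x, `|T x| <= c * `|x|.

(* opapp and mxop implement L(X, Y)^{n x m} ~ L(X^m, Y^n) in both
   directions. *)
Definition opapp (X : Type) (Y : nmodType) n m (T : 'M[X -> Y]_(n, m))
    (u : 'cV[X]_m) : 'cV[Y]_n :=
  \col_i \sum_j T i j (u j 0).

Definition mxop (X : nmodType) (Y : Type) n m (T : 'cV[X]_m -> 'cV[Y]_n) :
    'M[X -> Y]_(n, m) :=
  \matrix_(i, j) fun x => T (\col_k (if k == j then x else 0)) i 0.

Definition opmul (X Y : Type) (Z : nmodType) n k m (S : 'M[Y -> Z]_(n, k))
    (T : 'M[X -> Y]_(k, m)) : 'M[X -> Z]_(n, m) :=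
  \matrix_(i, j) fun x => \sum_l S i l (T l j x).

(* The value of the adjoint at y exists, and is unique, when T is bounded. *)
Definition adjoint (X Y : hilbertType R) (T : X -> Y) : Y -> X :=
  fun y => xget 0 [set x | forall x', inner (T x') y = inner x' x].

Definition adjmx (X Y : hilbertType R) n m (T : 'M[X -> Y]_(n, m)) :
    'M[Y -> X]_(m, n) :=
  \matrix_(i, j) adjoint (T j i).

Definition innercol (Y : hilbertType R) n (u v : 'cV[Y]_n) : C :=
  \sum_i inner (u i 0) (v i 0).

Definition op_ge0 (Y : hilbertType R) n (T : 'M[Y -> Y]_n) :=
  forall y : 'cV[Y]_n, 0 <= innercol (opapp T y) y.

Definition starmx (A : cstarAlgType R) n m (P : 'M[A]_(n, m)) :
    'M[A]_(m, n) := (map_mx (@star R A) P)^T.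

(* Positivity in the C*-algebra A^{n x n}. *)
Definition cstarmx_ge0 (A : cstarAlgType R) n (P : 'M[A]_n) :=
  exists Q : 'M[A]_n, P = starmx Q *m Q.

Definition unital_star_rep (A : cstarAlgType R) (V : hilbertType R)
    (sigma : A -> V -> V) :=
  [/\ forall a, bounded_op (sigma a),
      forall c a b, sigma (c *: a + b) = c *: sigma a + sigma b,
      forall a b, sigma (a * b) = sigma a \o sigma b,
      sigma 1 = id
    & forall a x y, inner (sigma (star a) x) y = inner x (sigma a y)].

Definition lscalemx (V : lmodType C) n k m (alpha : 'M[C]_(n, k))
    (Z : 'M[V]_(k, m)) : 'M[V]_(n, m) :=
  \matrix_(i, j) \sum_l alpha i l *: Z l j.

Definition rscalemx (V : lmodType C) n k m (Z : 'M[V]_(n, k))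
    (beta : 'M[C]_(k, m)) : 'M[V]_(n, m) :=
  \matrix_(i, j) \sum_l beta l j *: Z i l.

End Operators.

(* A subset of S_nc, given by its levels. *)
Definition ncset (S : Type) := forall n, set 'M[S]_n.

Definition dirsum (S : Type) (z : S) n m (Z : 'M[S]_n) (W : 'M[S]_m) :
    'M[S]_(n + m) :=
  block_mx Z (const_mx z) (const_mx z) W.

(* S_nc has no level 0.  The point z plays the role of zero: it is 0 when S is
   a vector space, and the adjoined formal zero when S = option S0 for a bare
   set S0. *)
Definition is_ncset (S : Type) (z : S) (Omega : ncset S) :=
  Omega 0%N = set0 /\
  forall n m (Z : 'M[S]_n) (W : 'M[S]_m),
    Omega n Z -> Omega m W -> Omega (n + m)%N (dirsum z Z W).

(* The types ncfun and nckernel make functions and kernels graded; that the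
   entries of the values are bounded operators is required separately. *)
Definition ncfun (S : Type) (Omega : ncset S) (X Y : Type) :=
  forall n, Omega n -> 'M[X -> Y]_n.

Definition nckernel (S : Type) (Omega : ncset S) (A Y : Type) :=
  forall n m, Omega n -> Omega m -> 'M[A]_(n, m) -> 'M[Y -> Y]_(n, m).

Section Functions.
Variable R : realType.
Local Notation C := R[i].

Definition op_valued (S : Type) (Omega : ncset S) (X Y : normedModType C)
    (f : ncfun Omega X Y) :=
  forall n (Z : Omega n) i j, bounded_op (f n Z i j).

Definition global_function (S : Type) (z : S) (Omega : ncset S)
    (X Y : normedModType C) (f : ncfun Omega X Y) :=
  op_valued f /\
  forall n m (Z : Omega n) (W : Omega m) (U : Omega (n + m)%N),
    \val U = dirsum z (\val Z) (\val W) ->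
    f _ U = dirsum 0 (f _ Z) (f _ W).

Definition nc_function (V : lmodType C) (Omega : ncset V)
    (X Y : normedModType C) (f : ncfun Omega X Y) :=
  op_valued f /\
  forall n m (Z : Omega n) (Z' : Omega m) (alpha : 'M[C]_(m, n)),
    lscalemx alpha (\val Z) = rscalemx (\val Z') alpha ->
    lscalemx alpha (f _ Z) = rscalemx (f _ Z') alpha.

(* Each K(Z, W) is a bounded linear map from A^{n x m} to L(Y)^{n x m}; for
   boundedness A^{n x m} may be given any norm inducing its product topology,
   here the sum of the norms of the entries. *)
Definition graded_kernel (S : Type) (Omega : ncset S) (A : cstarAlgType R)
    (Y : hilbertType R) (K : nckernel Omega A Y) :=
  forall n m (Z : Omega n) (W : Omega m),
    [/\ forall P i j, bounded_op (K _ _ Z W P i j),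
        forall (c : C) P Q,
          K _ _ Z W (map_mx ( *:%R c) P + Q) =
          map_mx ( *:%R c) (K _ _ Z W P) + K _ _ Z W Q
      & exists c : C, forall P i j y,
          `|K _ _ Z W P i j y| <= c * (\sum_k \sum_l `|P k l|) * `|y|].

Definition global_kernel (S : Type) (z : S) (Omega : ncset S)
    (A : cstarAlgType R) (Y : hilbertType R) (K : nckernel Omega A Y) :=
  graded_kernel K /\
  forall n n' m m' (Z : Omega n) (Z' : Omega n') (W : Omega m)
      (W' : Omega m') (ZZ' : Omega (n + n')%N) (WW' : Omega (m + m')%N),
    \val ZZ' = dirsum z (\val Z) (\val Z') ->
    \val WW' = dirsum z (\val W) (\val W') ->
    forall (P11 : 'M[A]_(n, m)) (P12 : 'M[A]_(n, m'))
        (P21 : 'M[A]_(n', m)) (P22 : 'M[A]_(n', m')),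
      K _ _ ZZ' WW' (block_mx P11 P12 P21 P22) =
      block_mx (K _ _ Z W P11) (K _ _ Z W' P12)
               (K _ _ Z' W P21) (K _ _ Z' W' P22).

Local Open Scope sesquilinear_scope.

Definition nc_kernel (V : lmodType C) (Omega : ncset V) (A : cstarAlgType R)
    (Y : hilbertType R) (K : nckernel Omega A Y) :=
  graded_kernel K /\
  forall n n' m m' (Z : Omega n) (Z' : Omega n') (W : Omega m)
      (W' : Omega m') (alpha : 'M[C]_(n', n)) (beta : 'M[C]_(m', m)),
    lscalemx alpha (\val Z) = rscalemx (\val Z') alpha ->
    lscalemx beta (\val W) = rscalemx (\val W') beta ->
    forall P : 'M[A]_(n, m),
      rscalemx (lscalemx alpha (K _ _ Z W P)) (beta ^t*) =
      K _ _ Z' W' (rscalemx (lscalemx alpha P) (beta ^t*)).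

Local Close Scope sesquilinear_scope.

Definition cp_kernel (S : Type) (Omega : ncset S) (A : cstarAlgType R)
    (Y : hilbertType R) (K : nckernel Omega A Y) :=
  forall n (Z : Omega n) (P : 'M[A]_n),
    cstarmx_ge0 P -> op_ge0 (K _ _ Z Z P).

(* K_{W,v,y}(Z) u = K(Z, W)(u v) y *)
Definition kernel_fun (S : Type) (Omega : ncset S) (A : cstarAlgType R)
    (Y : hilbertType R) (K : nckernel Omega A Y) m (W : Omega m)
    (v : 'rV[A]_m) (y : 'cV[Y]_m) : ncfun Omega A Y :=
  fun n Z => mxop (fun u : 'cV[A]_n => opapp (K _ _ Z W (u *m v)) y).

(* The Hilbert space F is a vector space of functions on Omega, with pointwise
   operations, through ev. *)
Definition function_space (S : Type) (Omega : ncset S)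
    (X Y : normedModType C) (F : hilbertType R) (ev : F -> ncfun Omega X Y) :=
  injective ev /\
  forall (c : C) (f g : F) n (Z : Omega n),
    ev (c *: f + g) n Z = map_mx ( *:%R c) (ev f n Z) + ev g n Z.

Definition global_rkhs (S : Type) (z : S) (Omega : ncset S)
    (A : cstarAlgType R) (Y : hilbertType R) (K : nckernel Omega A Y)
    (F : hilbertType R) (ev : F -> ncfun Omega A Y) :=
  [/\ function_space ev,
      forall f, global_function z (ev f),
      forall m (W : Omega m) (v : 'rV[A]_m) (y : 'cV[Y]_m),
        range ev (kernel_fun K W v y),
      forall m (W : Omega m) (v : 'rV[A]_m) (y : 'cV[Y]_m) (f k : F),
        ev k = kernel_fun K W v y ->
        innercol (opapp (ev f _ W) (starmx v)) y = inner f k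
    & exists sigma : A -> F -> F,
        [/\ unital_star_rep sigma,
            forall a f m (W : Omega m) (v : 'rV[A]_m),
              opapp (ev (sigma a f) _ W) (starmx v) =
              opapp (ev f _ W) (starmx v *m a%:M)
          & forall a m (W : Omega m) (v : 'rV[A]_m) (y : 'cV[Y]_m) (k : F),
              ev k = kernel_fun K W v y ->
              ev (sigma a k) = kernel_fun K W (a *: v) y]].

(* f_h(Z) u = H(Z) (id (x) sigma)(u) h *)
Definition lift_fun (S : Type) (Omega : ncset S) (A : cstarAlgType R)
    (X Y : hilbertType R) (sigma : A -> X -> X) (H : ncfun Omega X Y)
    (h : X) : ncfun Omega A Y :=
  fun n Z => mxop (fun u : 'cV[A]_n =>
    opapp (H n Z) (opapp (map_mx sigma u) (const_mx h : 'cV_1))).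

(* K(Z, W)(P) = H(Z) (id (x) sigma)(P) H(W)^* *)
Definition lift_kernel (S : Type) (Omega : ncset S) (A : cstarAlgType R)
    (X Y : hilbertType R) (sigma : A -> X -> X) (H : ncfun Omega X Y) :
    nckernel Omega A Y :=
  fun n m Z W P => opmul (opmul (H n Z) (map_mx sigma P)) (adjmx (H m W)).

Definition lift_space (S : Type) (Omega : ncset S) (A : cstarAlgType R)
    (X Y : hilbertType R) (sigma : A -> X -> X) (H : ncfun Omega X Y) :
    set (ncfun Omega A Y) :=
  [set f | exists h, f = lift_fun sigma H h].

End Functions.

Definition is_min (R : realType) (E : set R[i]) (x : R[i]) :=
  E x /\ lbound E x.

(* Main.v *)
Require Import Defs.
From HB Require Import structures.
From mathcomp Require Import all_boot all_order all_algebra.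
From mathcomp Require Import spectral sesquilinear ring.
From mathcomp Require Import all_classical all_reals topology normedtype.

Set Implicit Arguments.
Unset Strict Implicit.
Unset Printing Implicit Defensive.

Import Order.TTheory GRing.Theory Num.Theory Num.Def.
Import numFieldNormedType.Exports.

Local Open Scope classical_set_scope.
Local Open Scope ring_scope.

(**
The vectors h with f_h = 0 form a closed subspace N of the representation
space, invariant under sigma.  By the projection theorem every f_h equals f_k
for a unique k orthogonal to N, and this k has least norm; so the space of the
f_h is a copy of the orthogonal complement of N, which sigma leaves invariant.
The kernel function K_{W,v,y} is f_h for h = (id (x) sigma)(v) H(W)^* y, and
the reproducing property says that (id (x) sigma)(v^* ) and H(W) are moved
across the inner product.  Complete positivity follows in the same way from
P = Q^* Q.  That the f_h are bounded in the algebra variable rests on the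
automatic continuity of a *-representation: when the norm of a is 1/2 the
element 1 - a^* a is the square of a selfadjoint element, so sigma(a) is a
contraction.
*)

(** * Hilbert spaces over R[i] *)

Section ComplexNumbers.
Variable R : realType.
Local Notation C := R[i].

(** Both constants are real, so the claim moves to [R], where it follows from the archimedean
    property and n < 2^n. *)
Lemma ltr_exprV2_eventually (c e : C) : 0 <= c -> 0 < e ->
  \forall n \near \oo, c * 2^-1 ^+ n < e.
Proof.
move=> c0 e0.
have /complex_realP[c' cE] := ger0_real c0.
have /complex_realP[e' eE] := gtr0_real e0.
subst c e.
have {}c0 : 0 <= c' by rewrite -lecR.
have {}e0 : 0 < e' by rewrite -ltcR.
near=> n.
have -> : 2^-1 ^+ n = (2^-1 ^+ n : R)%:C%C :> C.
  by rewrite rmorphXn fmorphV rmorph_nat.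
rewrite -rmorphM ltcR exprVn ltr_pdivrMr ?exprn_gt0//.
apply: (@lt_trans _ _ (e' * n%:R)).
  rewrite mulrC -ltr_pdivrMr//.
  near: n; exact: nbhs_infty_gtr.
by rewrite ltr_pM2l// -natrX ltr_nat ltn_expl.
Unshelve. all: by end_near. Qed.

(** Most passages to the limit below take this form: a quantity bounded by every c 2^-n cannot be
    positive. *)
Lemma le0_exprV2 (c x : C) : 0 <= c ->
  (forall n, x <= c * 2^-1 ^+ n) -> x <= 0.
Proof.
move=> c0 H.
(* The order of R[i] is partial; being comparable with a real number makes x real. *)
have xr : x \is Num.real.
  by have := H 0%N; rewrite expr0 mulr1 => /ler_real ->; exact: ger0_real.
rewrite real_leNgt//; apply/negP => x0.
have [n _ /(_ n)/(_ (leqnn _)) /=] := ltr_exprV2_eventually c0 x0.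
by rewrite (le_gtF (H n)).
Qed.

End ComplexNumbers.

(** * Closed sets and completeness through geometric estimates *)

Section CompleteSpaces.
Variable R : realType.
Local Notation C := R[i].

Lemma closed_adherenceP (V : normedModType C) (N : set V) :
  closed N <->
  forall x, (forall e, 0 < e -> exists2 y, N y & `|x - y| < e) -> N x.
Proof.
split=> [cN x H|H x xN].
  apply: cN => B /nbhs_ballP[e /= e0 eB].
  have [y Ny xy] := H e e0.
  by exists y; split=> //; apply: eB; rewrite -ball_normE.
apply: H => e e0; have [y [Ny]] := xN _ (nbhsx_ballx x e e0).
by rewrite -ball_normE; exists y.
Qed.

(** The factor 2 sums the geometric series. The rate is kept explicit so that later limits reduce to
    [le0_exprV2]. *)
Lemma cauchy_geometric (V : completeNormedModType C) (x : nat -> V) (c : C) :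
    0 <= c -> (forall n, `|x n - x n.+1| <= c * 2^-1 ^+ n) ->
  exists l, forall n, `|x n - l| <= 2 * c * 2^-1 ^+ n.
Proof.
move=> c0 H.
(* The right side is the exact partial sum of the series, which lets the induction on k close. *)
have dist n k : `|x n - x (n + k)%N| <= 2 * c * 2^-1 ^+ n * (1 - 2^-1 ^+ k).
  elim: k => [|k IH]; first by rewrite addn0 subrr normr0 expr0 subrr mulr0.
  apply: le_trans (ler_distD (x (n + k)%N) _ _) _.
  rewrite addnS; apply: le_trans (lerD IH (H _)) _.
  by rewrite exprD exprSr le_eqVlt; apply/orP; left; apply/eqP; field.
have dist2 n k : (n <= k)%N -> `|x n - x k| <= 2 * c * 2^-1 ^+ n.
  move=> nk; rewrite -(subnKC nk); apply: le_trans (dist _ _) _.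
  rewrite ler_piMr ?mulr_ge0 ?exprn_ge0 ?invr_ge0//.
  by rewrite gerBl exprn_ge0 ?invr_ge0.
have cx : cvgn x.
  apply/cauchy_cvgP; apply/cauchy_exP => e e0.
  have c20 : 0 <= 2 * c by rewrite mulr_ge0.
  have [n _ /(_ n)/(_ (leqnn _)) /= ne] := ltr_exprV2_eventually c20 e0.
  exists (x n); exists n => // k /= nk.
  rewrite -ball_normE /=; exact: le_lt_trans (dist2 _ _ nk) ne.
exists (limn x) => n; rewrite -subr_le0; apply: (@le0_exprV2 _ 1) => // m.
rewrite mul1r; have e0 : 0 < 2^-1 ^+ m :> C by rewrite exprn_gt0 ?invr_gt0.
move/cvgrPdist_le : cx => /(_ _ e0) [k _ kP].
rewrite lerBlDl (le_trans (ler_distD (x (maxn n k)) _ _))// lerD//.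
  by rewrite dist2// leq_maxl.
by rewrite distrC kP//= leq_maxr.
Qed.

End CompleteSpaces.

(** * The Cauchy-Schwarz inequality and the projection theorem *)

Section HilbertSpaces.
Variables (R : realType) (X : hilbertType R).
Local Notation C := R[i].

Lemma inner_conj (x y : X) : inner x y = (inner y x)^*.
Proof. by rewrite hermC/= expr0 mul1r. Qed.

(** Pythagoras for the removal from x of its component along y; it gives both Cauchy-Schwarz and the
    near orthogonality of near minimizers. *)
Lemma norm_sub_proj (x y : X) : y != 0 ->
  `|x - (inner x y / `|y| ^+ 2) *: y| ^+ 2 =
  `|x| ^+ 2 - `|inner x y| ^+ 2 / `|y| ^+ 2.
Proof.
move=> y0; rewrite !sqr_norm_inner.
have n0 : inner y y != 0 by rewrite dnorm_eq0.
rewrite dnormB dnormZ normrM normfV (ger0_norm (dnorm_ge0 _ y)).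
rewrite linearZr_LR/= !rmorphM/= conjCK !fmorphV/= exprMn normCK.
rewrite !(geC0_conj (dnorm_ge0 _ y)).
by field.
Qed.

Lemma norm_inner_le (x y : X) : `|inner x y| <= `|x| * `|y|.
Proof.
have [->|y0] := eqVneq y 0; first by rewrite linear0r !normr0 mulr0.
have y2 : 0 < `|y| ^+ 2 by rewrite exprn_gt0// normr_gt0.
rewrite -ler_sqr ?nnegrE ?mulr_ge0// exprMn -ler_pdivrMr// -subr_ge0.
by rewrite -norm_sub_proj// exprn_ge0.
Qed.

Lemma inner_eq_ext (x y : X) : (forall z, inner z x = inner z y) -> x = y.
Proof.
move=> H; apply/eqP; rewrite -subr_eq0 -(dnorm_eq0 inner).
by rewrite linearB/= H subrr.
Qed.

Definition subspace (N : set X) :=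
  N 0 /\ forall c x y, N x -> N y -> N (c *: x + y).

(** Take x in N with squared distance to h less than e^2 above the infimum over N. Moving x along y
    can lower this squared distance by |<h - x, y>|^2 / |y|^2, which therefore is less than e^2. *)
Lemma almost_orthogonal (N : set X) (h : X) (e : C) : subspace N -> 0 < e ->
  exists2 x, N x & forall y, N y -> `|inner (h - x) y| <= e * `|y|.
Proof.
move=> [N0 NL] e0.
(* Norms take values in R[i]; the infimum is formed in [R]. *)
pose q (v : X) : R := complex.Re (`|v| ^+ 2).
have qE v : `|v| ^+ 2 = (q v)%:C%C by rewrite RRe_real// rpredX ?normr_real.
have q0 v : 0 <= q v by rewrite -lecR -qE exprn_ge0.
pose S := [set q (h - y) | y in N].
have Si : has_inf S.
  by split; [exists (q (h - 0)), 0|exists 0 => _ [y _ <-]].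
have /complex_realP[e' eE] := gtr0_real e0.
have e'0 : 0 < e' by rewrite -ltcR -eE.
have [_ [x Nx <-] xe] := inf_adherent (exprn_gt0 2 e'0) Si.
exists x => // y Ny.
have [->|y0] := eqVneq y 0; first by rewrite linear0r !normr0 mulr0.
have y2 : 0 < `|y| ^+ 2 by rewrite exprn_gt0// normr_gt0.
rewrite -ler_sqr ?nnegrE ?mulr_ge0//; last exact: ltW.
rewrite exprMn -ler_pdivrMr//.
have := norm_sub_proj (h - x) y0.
set t := _ / _ => tE.
have : inf S <= q (h - x - t *: y).
  apply: ge_inf; first exact: Si.2.
  exists (t *: y + x); first exact: NL.
  by rewrite opprD addrA addrAC.
move: xe; rewrite -ltrBlDr => /lt_le_trans xe /xe {xe}.
by rewrite -ltcR rmorphB rmorphXn /= -!qE tE -eE ltrD2l ltrN2 => /ltW.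
Qed.

(** The 2^-n-orthogonal approximants form a Cauchy sequence: the difference of two of them lies in
    N, so it can itself serve as the test vector y. *)
Theorem projection (N : set X) (h : X) : subspace N -> closed N ->
  exists2 p, N p & forall y, N y -> inner (h - p) y = 0.
Proof.
move=> Ns Nc.
have e0 n : 0 < 2^-1 ^+ n :> C by rewrite exprn_gt0 ?invr_gt0.
have /choice[x xP] n : exists x, N x /\
    forall y, N y -> `|inner (h - x) y| <= 2^-1 ^+ n * `|y|.
  by have [x ? ?] := almost_orthogonal h Ns (e0 n); exists x.
have NB y z : N y -> N z -> N (y - z).
  by move=> Ny Nz; rewrite addrC -scaleN1r; exact: Ns.2.
have dx n : `|x n - x n.+1| <= 2 * 2^-1 ^+ n.
  set z := _ - _; have Nz : N z by apply: NB; apply (xP _).1.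
  have [->|z0] := eqVneq z 0; first by rewrite normr0 mulr_ge0// ltW.
  have {z0} : 0 < `|z| by rewrite normr_gt0.
  move=> /ler_pM2r <-; rewrite -expr2 sqr_norm_inner.
  have {1}-> : z = (h - x n.+1) - (h - x n).
    by rewrite opprB addrC addrA subrK.
  rewrite linearBl/= -[leLHS]ger0_norm; last first.
    by rewrite -linearBl/= opprB addrC addrA subrK -sqr_norm_inner exprn_ge0.
  apply: (le_trans (ler_normB _ _)).
  rewrite -mulrA mulr_natl mulr2n lerD ?(xP _).2//.
  apply: (le_trans ((xP _).2 _ Nz)); rewrite ler_wpM2r//.
  by rewrite exprS ler_piMl ?invf_le1 ?ler1n// ltW.
have [l lP] := cauchy_geometric (ler0n _ _) dx.
exists l.
  move/closed_adherenceP: Nc; apply=> e.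
  have c0 : (0 : C) <= 2 * 2 by rewrite mulr_ge0.
  move=> /(ltr_exprV2_eventually c0)[n _ /(_ n)/(_ (leqnn _)) /= ne].
  by exists (x n); [exact: (xP _).1|rewrite distrC (le_lt_trans (lP n))].
move=> y Ny; apply/eqP; rewrite -normr_le0.
(* 5 = 1 + 4: the 1 comes from the near orthogonality of x n, the 4 from its distance to l. *)
apply: (@le0_exprV2 _ (5 * `|y|)) => [|n]; first by rewrite mulr_ge0.
have -> : h - l = (h - x n) + (x n - l) by rewrite addrA subrK.
rewrite linearDl/= (le_trans (ler_normD _ _))//.
have lPy := le_trans (norm_inner_le _ _) (ler_wpM2r (normr_ge0 y) (lP n)).
have := lerD ((xP n).2 _ Ny) lPy.
by move=> /le_trans; apply; rewrite le_eqVlt; apply/orP; left; apply/eqP; ring.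
Qed.

End HilbertSpaces.

(** * Riesz representation and adjoints *)

Section Adjoints.
Variable R : realType.
Local Notation C := R[i].

(** Turns the predicate into a bundled linear map, to which the general lemmas on linear maps
    apply. *)
Lemma linear_map_of (X Y : lmodType C) (T : X -> Y) : linear T ->
  exists f : {linear X -> Y}, T = f.
Proof.
move=> Tl; pose lT := GRing.isLinear.Build C X Y _ T Tl.
by exists (HB.pack_for {linear X -> Y} T lT).
Qed.

(** The bound c in [bounded_op] is any element of R[i]; its modulus serves as well, since c |x| is
    nonnegative. *)
Lemma bounded_op_ge0 (X Y : normedModType C) (T : X -> Y) : bounded_op T ->
  exists2 c : C, 0 <= c & forall x, `|T x| <= c * `|x|.
Proof.
move=> [_ [c cP]]; exists `|c| => // x; rewrite -[`|x|]normr_id -normrM.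
by rewrite ger0_norm// (le_trans _ (cP x)).
Qed.

Lemma closed_ker (X Y : normedModType C) (T : X -> Y) : bounded_op T ->
  closed [set x | T x = 0].
Proof.
move=> Tb; apply/closed_adherenceP => x xP /=.
have [c c0 cP] := bounded_op_ge0 Tb; have [f fE] := linear_map_of Tb.1.
apply/eqP; rewrite -normr_le0; apply: (le0_exprV2 c0) => n.
have [|y /= y0 xy] := xP (2^-1 ^+ n); first by rewrite exprn_gt0 ?invr_gt0.
have -> : T x = T (x - y) by rewrite fE linearB -fE y0 subr0.
by rewrite (le_trans (cP _))// ler_wpM2l// ltW.
Qed.

Lemma subspace_ker (X : hilbertType R) (Y : normedModType C) (T : X -> Y) :
  bounded_op T -> subspace [set x | T x = 0].
Proof.
move=> [Tl _]; have [f ->] := linear_map_of Tl.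
by split=> [|c x y /= x0 y0]; rewrite /= ?linear0// linearP x0 y0 scaler0 addr0.
Qed.

(** If phi h is nonzero, the component e of h orthogonal to the kernel spans the orthogonal
    complement of the kernel, and a multiple of e represents phi. *)
Theorem riesz (X : hilbertType R) (phi : X -> C^o) : bounded_op phi ->
  exists z, forall x, phi x = inner x z.
Proof.
move=> phib; have [f fE] := linear_map_of phib.1.
have [[h h0]|phi0] := pselect (exists h, phi h != 0); last first.
  exists 0 => x; rewrite linear0r; apply/eqP.
  by apply: contra_notT phi0 => x0; exists x.
have [p /= p0 pP] := projection h (subspace_ker phib) (closed_ker phib).
set e := h - p in pP.
have e0 : phi e != 0 by rewrite fE linearB -fE/= p0 subr0.
have ne0 : inner e e != 0.
  by rewrite dnorm_eq0; apply: contra_neq e0 => ->; rewrite fE linear0.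
exists ((phi e / inner e e)^* *: e) => x.
(* Every x is a multiple of e up to an element of the kernel. *)
have /pP : phi (x - (phi x / phi e) *: e) = 0.
  by rewrite fE linearB linearZ/= -fE [_ *: _]divfK// subrr.
rewrite inner_conj linearBl/= linearZl_LR/= => /eqP.
rewrite conjC_eq0 subr_eq0 => /eqP xe.
by rewrite linearZr_LR/= conjCK xe; field; rewrite e0.
Qed.

Section Adjoint.
Variables X Y : hilbertType R.

Lemma bounded_op_inner (T : X -> Y) (y : Y) : bounded_op T ->
  bounded_op ((fun x => inner (T x) y) : X -> C^o).
Proof.
move=> Tb; have [c c0 cP] := bounded_op_ge0 Tb.
have [f fE] := linear_map_of Tb.1; split.
  by move=> a u v; rewrite fE linearP linearDl/= linearZl_LR.
exists (c * `|y|) => x; apply: le_trans (norm_inner_le _ _) _.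
by rewrite mulrAC ler_wpM2r.
Qed.

(** The choice made in [adjoint] succeeds because Riesz represents the functional x |-> <T x, y>. *)
Lemma adjointP (T : X -> Y) : bounded_op T ->
  forall x y, inner (T x) y = inner x (adjoint T y).
Proof.
move=> Tb x y; have [z zP] := riesz (bounded_op_inner y Tb).
move: x; apply: (@xgetPex _ 0 [set z | forall x', inner (T x') y = inner x' z]).
by exists z.
Qed.

Lemma adjoint_unique (T : X -> Y) (S : Y -> X) :
  (forall x y, inner (T x) y = inner x (S y)) -> adjoint T = S.
Proof.
move=> TS; apply/funext => y; apply: inner_eq_ext => x; rewrite -TS.
apply/esym; move: x.
apply: (@xgetPex _ 0 [set z | forall x', inner (T x') y = inner x' z]).
by exists (S y).
Qed.

(** With S the adjoint of T, |S y|^2 = <T S y, y> <= c |S y| |y|, and |S y| cancels; the bound of T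
    is kept. *)
Lemma bounded_op_adjoint (T : X -> Y) : bounded_op T -> bounded_op (adjoint T).
Proof.
move=> Tb; split.
  move=> a u v; apply: inner_eq_ext => x.
  rewrite -adjointP// linearD/= linearZr_LR/= [RHS]linearD/= linearZr_LR/=.
  by rewrite !adjointP.
have [c c0 cP] := bounded_op_ge0 Tb; exists c => y.
have [->|z0] := eqVneq (adjoint T y) 0; first by rewrite normr0 mulr_ge0.
have {z0} : 0 < `|adjoint T y| by rewrite normr_gt0.
move=> /ler_pM2r <-; rewrite -expr2 sqr_norm_inner -adjointP//.
rewrite -[leLHS]ger0_norm; last by rewrite adjointP// dnorm_ge0.
rewrite (le_trans (norm_inner_le _ _))// mulrAC.
by rewrite ler_wpM2r.
Qed.

End Adjoint.

End Adjoints.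

(** * The orthogonal complement as a Hilbert space *)

Section Sub.
Variables (R : realType) (X : hilbertType R) (N : set X).
Local Notation C := R[i].

(** A boolean predicate, so that the subtype of its elements inherits the module structure of X. *)
Definition orthc : {pred X} :=
  fun x => `[< forall y, N y -> inner x y = 0 >].

Lemma orthcP x : reflect (forall y, N y -> inner x y = 0) (x \in orthc).
Proof. exact: asboolP. Qed.

Fact orthc_submod : subsemimod_closed orthc.
Proof.
split; first split.
- by apply/orthcP => y _; rewrite linear0l.
- move=> x y /orthcP x0 /orthcP y0; apply/orthcP => z Nz.
  by rewrite linearDl/= x0// y0// addr0.
- move=> c x /orthcP x0; apply/orthcP => z Nz.
  by rewrite linearZl_LR/= x0// mulr0.
Qed.
HB.instance Definition _ := GRing.isSubmodClosed.Build C X orthc orthc_submod.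

Definition orthsp := {x : X | x \in orthc}.
HB.instance Definition _ := [isSub of orthsp for sval].
HB.instance Definition _ := [Choice of orthsp by <:].
HB.instance Definition _ := [SubChoice_isSubLmodule of orthsp by <:].

Let nrm (x : orthsp) : C := `|val x|.
Fact nrmD x y : nrm (x + y) <= nrm x + nrm y.
Proof. by rewrite /nrm/=; exact: ler_normD. Qed.
Fact nrmZ (l : C) x : nrm (l *: x) = `|l| * nrm x.
Proof. by rewrite /nrm/=; exact: normrZ. Qed.
Fact nrm0_eq0 x : nrm x = 0 -> x = 0.
Proof. by move/normr0_eq0 => x0; apply: val_inj; rewrite x0. Qed.
HB.instance Definition _ := Lmodule_isNormed.Build C orthsp nrmD nrmZ nrm0_eq0.

Lemma closed_orthc : closed [set x | x \in orthc].
Proof.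
apply/closed_adherenceP => x xP; apply/orthcP => y Ny.
apply/eqP; rewrite -normr_le0; apply: (@le0_exprV2 _ `|y|) => // n.
have [|z /= /orthcP /(_ y Ny) zy xz] := xP (2^-1 ^+ n).
  by rewrite exprn_gt0 ?invr_gt0.
rewrite -[inner x y]subr0 -zy -linearBl/= mulrC.
by rewrite (le_trans (norm_inner_le _ _))// ler_wpM2r// ltW.
Qed.

(** A Cauchy filter converges in X, and the limit stays in the complement, which is closed. *)
Lemma orthsp_complete (G : set_system orthsp) :
  ProperFilter G -> cauchy G -> cvg G.
Proof.
move=> GF /cauchyP Gc.
have /cvg_ex[l lP] : cvg ((val : orthsp -> X) @ G).
  apply/cauchy_cvgP; apply/cauchy_exP => e e0.
  have [x Gx] := Gc e e0; exists (val x).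
  rewrite /fmap /=; apply: (@filterS _ G) Gx => y.
  by rewrite -!ball_normE.
have lN : l \in orthc.
  apply: (closed_cvg (fun x => x \in orthc) closed_orthc _ _ lP).
  by apply: nearW => x; exact: valP.
apply/cvg_ex; exists (Sub l lN); apply/cvgrPdist_lt => e e0.
by move/cvgrPdist_lt: lP => /(_ e e0); apply: filterS => x /=.
Qed.
HB.instance Definition _ := Uniform_isComplete.Build orthsp orthsp_complete.

Definition orthsp_inner (x y : orthsp) : C := inner (val x) (val y).

Fact orthsp_inner_bilinear :
  bilinear_for *%R (conjC \; *%R) orthsp_inner.
Proof.
split=> z c x y; rewrite /orthsp_inner/=.
  by rewrite linearDl/= linearZl_LR.
by rewrite linearD/= linearZr_LR.
Qed.
HB.instance Definition _ := bilinear_isBilinear.Build C orthsp orthsp C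
  *%R (conjC \; *%R) orthsp_inner orthsp_inner_bilinear.
Fact orthsp_inner_hermitian (x y : orthsp) :
  orthsp_inner x y = (-1) ^+ false * conjC (orthsp_inner y x).
Proof. exact: hermC. Qed.
HB.instance Definition _ := isHermitianSesquilinear.Build C orthsp false conjC
  orthsp_inner orthsp_inner_hermitian.
Fact orthsp_inner_gt0 (x : orthsp) : x != 0 -> 0 < orthsp_inner x x.
Proof. by move=> x0; apply: neq0_dnorm_gt0. Qed.
HB.instance Definition _ :=
  isDotProduct.Build C orthsp orthsp_inner orthsp_inner_gt0.
Fact orthsp_sqr_norm (x : orthsp) : `|x| ^+ 2 = orthsp_inner x x.
Proof. exact: sqr_norm_inner. Qed.
HB.instance Definition _ := isHilbert.Build R orthsp orthsp_sqr_norm.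

Lemma inner_orthsp (x y : orthsp) : inner x y = inner (val x) (val y).
Proof. by []. Qed.

Lemma norm_orthsp (x : orthsp) : `|x| = `|val x|.
Proof. by []. Qed.

End Sub.

(** * C*-algebras *)

Section CStarAlgebras.
Variables (R : realType) (A : cstarAlgType R).
Local Notation C := R[i].

Lemma norm_cstarM (a b : A) : `|a * b| <= `|a| * `|b|.
Proof. exact: cstar_normM. Qed.

(** The C*-identity and submultiplicativity give |b|^2 <= |star b| |b|; this is used for b = a and b
    = star a. *)
Lemma norm_star (a : A) : `|star a| = `|a|.
Proof.
have le_star (b : A) : `|b| <= `|star b|.
  have [->|b0] := eqVneq b 0; first by rewrite normr0.
  have {b0} : 0 < `|b| by rewrite normr_gt0.
  by move=> /ler_pM2r <-; rewrite -expr2 -cstar_norm cstar_normM.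
by apply/le_anti; rewrite le_star -{2}[a]starK le_star.
Qed.

Lemma starB (a b : A) : star (a - b) = star a - star b.
Proof. by rewrite -scaleN1r starD starZ rmorphN1 scaleN1r. Qed.

Lemma star1 : star (1 : A) = 1.
Proof.
have s1 : star (1 * star 1 : A) = star (star 1) * star 1 := starM _ _.
by rewrite mul1r starK mul1r in s1.
Qed.

(* The square root of [1 - b] is [1 - y], where [y] is the limit of the
   iteration [y := (b + y ^+ 2) / 2], a contraction of the ball of radius
   1/2. *)
Lemma cstar_sqrt1B (b : A) : star b = b -> `|b| <= 2^-1 ->
  exists2 c : A, star c = c & c * c = 1 - b.
Proof.
move=> bs b2.
pose F (y : A) : A := 2^-1 *: (b + y * y).
have h0 : 0 <= 2^-1 :> C by rewrite invr_ge0.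
have nF y : `|y| <= 2^-1 -> `|F y| <= 2^-1.
  move=> y2; rewrite normrZ ger0_norm// -[leRHS]mulr1 ler_wpM2l//.
  have -> : (1 : C) = 2^-1 + 2^-1 by field.
  rewrite (le_trans (ler_normD _ _))// lerD//.
  rewrite (le_trans (norm_cstarM _ _))// (le_trans (ler_pM _ _ y2 y2))//.
  by rewrite ler_piMl// invf_le1 ?ler1n.
have dF y z : `|y| <= 2^-1 -> `|z| <= 2^-1 -> `|F y - F z| <= 2^-1 * `|y - z|.
  move=> y2 z2; rewrite -scalerBr normrZ ger0_norm// ler_wpM2l//.
  (* A difference of squares without commutativity; on the ball it is at most |y - z|, so F halves
     distances. *)
  have -> : b + y * y - (b + z * z) = y * (y - z) + (y - z) * z.
    by rewrite mulrBr mulrBl addrA subrK opprD addrACA subrr add0r.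
  have -> : `|y - z| = 2^-1 * `|y - z| + `|y - z| * 2^-1 by field.
  rewrite (le_trans (ler_normD _ _))// lerD//.
    by rewrite (le_trans (norm_cstarM _ _))// ler_wpM2r.
  by rewrite (le_trans (norm_cstarM _ _))// ler_wpM2l.
pose x n := iter n F 0.
have x2 n : `|x n| <= 2^-1.
  by elim: n => [|n IH]; [rewrite normr0|exact: nF].
have dx n : `|x n - x n.+1| <= 1 * 2^-1 ^+ n.
  rewrite mul1r; elim: n => [|n IH].
    by rewrite distrC subr0 expr0 (le_trans (x2 1%N))// invf_le1 ?ler1n//.
  rewrite (le_trans (dF (x n) (x n.+1) (x2 n) (x2 n.+1)))// exprS.
  by rewrite ler_wpM2l.
have xs n : star (x n) = x n.
  elim: n => [|n IH]; first by rewrite -[x 0%N](subrr 0) starB !subrr.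
  rewrite /x iterS -/(x n) /F starZ fmorphV/= rmorph_nat starD bs.
  by rewrite -[_ * _]/(cstar_mul _ _) starM IH.
have [l lP] := cauchy_geometric ler01 dx; rewrite mulr1 in lP.
have l2 : `|l| <= 2^-1.
  rewrite -subr_le0; apply: (@le0_exprV2 _ 2) => // n; rewrite lerBlDl.
  rewrite -[l](subrK (x n)) addrC (le_trans (ler_normD _ _))//.
  by rewrite lerD ?x2// distrC lP.
have lF : F l = l.
  apply/eqP; rewrite -subr_eq0 -normr_le0; apply: (@le0_exprV2 _ 2) => // n.
  rewrite (le_trans (ler_distD (F (x n)) _ _))//.
  rewrite (le_trans (lerD (dF l (x n) l2 (x2 n)) (lP n.+1)))//.
  rewrite distrC exprS.
  have -> : 2 * 2^-1 ^+ n =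
      2^-1 * (2 * 2^-1 ^+ n) + 2 * (2^-1 * 2^-1 ^+ n) :> C.
    by field.
  by rewrite lerD2r ler_wpM2l.
have ls : star l = l.
  apply/eqP; rewrite -subr_eq0 -normr_le0; apply: (@le0_exprV2 _ 4) => // n.
  rewrite (le_trans (ler_distD (x n) _ _))// -{1}[x n]xs -starB norm_star.
  rewrite [`|l - _|]distrC (le_trans (lerD (lP n) (lP n)))//.
  by rewrite le_eqVlt; apply/orP; left; apply/eqP; ring.
exists (1 - l); first by rewrite starB star1 ls.
(* The fixed point equation, doubled; it rearranges to (1 - l)^2 = 1 - b. *)
have {lF} : b + l * l = l + l.
  by rewrite -[in RHS]lF -mulr2n -scaler_nat scalerA divff ?scale1r// pnatr_eq0.
move=> /(canRL (addrK _)) ->.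
by rewrite mulrBl mul1r mulrBr mulr1 -addrA -opprD [l + (l - _)]addrA.
Qed.

(** Contractivity is proved for elements of norm 1/2 only, where the square root is available;
    rescaling a to that norm costs the factor 2. *)
Lemma star_rep_bound (V : hilbertType R) (sigma : A -> V -> V) (a : A) (h : V) :
  unital_star_rep sigma -> `|sigma a h| <= 2 * `|a| * `|h|.
Proof.
move=> [_ sL sM s1 sS].
have sZ c b x : sigma (c *: b) x = c *: sigma b x.
  have s0 : sigma 0 = 0.
    by have := sL (-1) 0 0; rewrite scaler0 addr0 scaleN1r addNr.
  by have := sL c b 0; rewrite addr0 s0 addr0 => ->.
have contr (b : A) : `|b| = 2^-1 -> `|sigma b h| <= `|h|.
  move=> b2; rewrite -ler_sqr ?nnegrE// !sqr_norm_inner -subr_ge0.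
  have [||c cs cc] := @cstar_sqrt1B (star b * b).
  - by rewrite -[_ * _]/(cstar_mul _ _) starM starK.
  - rewrite [`|_|]cstar_norm b2 expr2 ler_piMl ?invr_ge0//.
    by rewrite invf_le1 ?ler1n.
  rewrite -sS.
  have -> : sigma (star b) (sigma b h) = h - sigma c (sigma c h).
    rewrite -[sigma c _]/((sigma c \o sigma c) h) -sM cc [1 - _]addrC.
    rewrite -(scaleN1r (star b * b)) sL s1 sM.
    rewrite -[RHS]/(h - (-1 *: sigma (star b) (sigma b h) + h)).
    by rewrite scaleN1r opprD opprK addrCA subrr addr0.
  (* What remains of |h|^2 - |sigma(b) h|^2 is <sigma(c) sigma(c) h, h> = |sigma(c) h|^2. *)
  rewrite linearBl/= subKr -{1}cs sS.
  exact: dnorm_ge0.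
have [->|a0] := eqVneq a 0.
  have -> : sigma 0 h = 0 by rewrite -(scale0r 0) sZ scale0r.
  by rewrite !normr0 mulr0 mul0r.
have a1 : 0 < `|a| by rewrite normr_gt0.
pose t := (2 * `|a|)^-1.
have t0 : 0 < t by rewrite invr_gt0 mulr_gt0.
have := contr (t *: a); rewrite sZ !normrZ (gtr0_norm t0) => H.
rewrite -ler_pdivrMl ?mulr_gt0//; apply: H.
by rewrite /t; field; rewrite gt_eqF.
Qed.

End CStarAlgebras.

(** * Matrices of bounded operators *)

Section BoundedOperators.
Variable R : realType.
Local Notation C := R[i].
Section Morphism.
Variables (X Y : normedModType C) (T : X -> Y).
Hypothesis Tb : bounded_op T.

Lemma bounded_opD x y : T (x + y) = T x + T y.
Proof. by have [f ->] := linear_map_of Tb.1; exact: linearD. Qed.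

Lemma bounded_opB x y : T (x - y) = T x - T y.
Proof. by have [f ->] := linear_map_of Tb.1; exact: linearB. Qed.

Lemma bounded_op0 : T 0 = 0.
Proof. by have [f ->] := linear_map_of Tb.1; exact: linear0. Qed.

Lemma bounded_opZ c x : T (c *: x) = c *: T x.
Proof. by have [f ->] := linear_map_of Tb.1; exact: linearZ. Qed.

Lemma bounded_op_sum (I : finType) (u : I -> X) :
  T (\sum_i u i) = \sum_i T (u i).
Proof. by have [f ->] := linear_map_of Tb.1; exact: linear_sum. Qed.

End Morphism.

Lemma bounded_op_cst0 (X Y : normedModType C) : bounded_op (0 : X -> Y).
Proof.
split; first by move=> c x y; rewrite /= scaler0 addr0.
by exists 0 => x; rewrite normr0 mul0r.
Qed.

Lemma bounded_op_comp (X Y Z : normedModType C) (S : Y -> Z) (T : X -> Y) :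
  bounded_op S -> bounded_op T -> bounded_op (fun x => S (T x)).
Proof.
move=> Sb Tb; split.
  move=> c x y; rewrite (bounded_opD Tb) (bounded_opZ Tb).
  by rewrite (bounded_opD Sb) (bounded_opZ Sb).
have [c c0 cP] := bounded_op_ge0 Sb; have [d d0 dP] := bounded_op_ge0 Tb.
exists (c * d) => x; rewrite (le_trans (cP _))// -mulrA.
by rewrite ler_wpM2l.
Qed.

Lemma bounded_op_add (X Y : normedModType C) (S T : X -> Y) :
  bounded_op S -> bounded_op T -> bounded_op (fun x => S x + T x).
Proof.
move=> Sb Tb; split.
  move=> c x y; rewrite (bounded_opD Sb) (bounded_opZ Sb).
  rewrite (bounded_opD Tb) (bounded_opZ Tb).
  by rewrite scalerDr addrACA.
have [c c0 cP] := bounded_op_ge0 Sb; have [d d0 dP] := bounded_op_ge0 Tb.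
exists (c + d) => x; rewrite (le_trans (ler_normD _ _))// mulrDl.
by rewrite lerD.
Qed.

Lemma bounded_op_bigsum (X Y : normedModType C) n (T : 'I_n -> X -> Y) :
  (forall i, bounded_op (T i)) -> bounded_op (fun x => \sum_i T i x).
Proof.
elim: n T => [|n IH] T Tb.
  have -> : (fun x => \sum_i T i x) = 0.
    by apply/funext => x; rewrite big_ord0.
  exact: bounded_op_cst0.
have -> : (fun x => \sum_i T i x) =
    (fun x => T ord0 x + \sum_i T (lift ord0 i) x).
  by apply/funext => x; rewrite big_ord_recl.
by apply: bounded_op_add => //; exact: IH.
Qed.

Definition bounded_mx (X Y : normedModType C) n m (T : 'M[X -> Y]_(n, m)) :=
  forall i j, bounded_op (T i j).

(** The sum of nonnegative bounds of the entries serves all entries at once. *)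
Lemma bounded_mx_bound (X Y : normedModType C) n m (T : 'M[X -> Y]_(n, m)) :
  bounded_mx T ->
  exists2 c : C, 0 <= c & forall i j x, `|T i j x| <= c * `|x|.
Proof.
move=> Tb.
have /choice[c cP] (ij : 'I_n * 'I_m) : exists c : C,
    0 <= c /\ forall x, `|T ij.1 ij.2 x| <= c * `|x|.
  by have [c ? ?] := bounded_op_ge0 (Tb ij.1 ij.2); exists c.
exists (\sum_ij c ij); first by apply: sumr_ge0 => ij _; exact: (cP ij).1.
move=> i j x; rewrite (le_trans ((cP (i, j)).2 x))// ler_wpM2r//.
rewrite (bigD1 (i, j))//= lerDl.
by apply: sumr_ge0 => ij _; exact: (cP ij).1.
Qed.

Lemma bounded_mx_opmul (X Y Z : normedModType C) n k m
    (S : 'M[Y -> Z]_(n, k)) (T : 'M[X -> Y]_(k, m)) :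
  bounded_mx S -> bounded_mx T -> bounded_mx (opmul S T).
Proof.
move=> Sb Tb i j; rewrite mxE; apply: bounded_op_bigsum => l.
exact: bounded_op_comp.
Qed.

Lemma opapp_opmul (X : Type) (Y Z : normedModType C) n k m
    (S : 'M[Y -> Z]_(n, k)) (T : 'M[X -> Y]_(k, m)) (u : 'cV[X]_m) :
  bounded_mx S -> opapp (opmul S T) u = opapp S (opapp T u).
Proof.
move=> Sb; apply/matrixP => i j; rewrite !mxE.
under eq_bigr => l _ do rewrite mxE.
rewrite exchange_big/=; apply: eq_bigr => l _.
by rewrite mxE (bounded_op_sum (Sb _ _)).
Qed.

Lemma opmul_block (X Y : Type) (Z : nmodType) n1 n2 k1 k2 m1 m2
    (S11 : 'M[Y -> Z]_(n1, k1)) (S12 : 'M[Y -> Z]_(n1, k2))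
    (S21 : 'M[Y -> Z]_(n2, k1)) (S22 : 'M[Y -> Z]_(n2, k2))
    (T11 : 'M[X -> Y]_(k1, m1)) (T12 : 'M[X -> Y]_(k1, m2))
    (T21 : 'M[X -> Y]_(k2, m1)) (T22 : 'M[X -> Y]_(k2, m2)) :
  opmul (block_mx S11 S12 S21 S22) (block_mx T11 T12 T21 T22) =
  block_mx (opmul S11 T11 + opmul S12 T21) (opmul S11 T12 + opmul S12 T22)
           (opmul S21 T11 + opmul S22 T21) (opmul S21 T12 + opmul S22 T22).
Proof.
apply/matrixP => i j.
case: (split_ordP i) => {}i ->; case: (split_ordP j) => {}j ->; rewrite
  ?block_mxEul ?block_mxEur ?block_mxEdl ?block_mxEdr !mxE;
  apply/funext => x; rewrite big_split_ord/=; congr (_ + _);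
  by apply: eq_bigr => l _; rewrite
    ?block_mxEul ?block_mxEur ?block_mxEdl ?block_mxEdr.
Qed.

Lemma opmul0l (X Y : Type) (Z : nmodType) n k m (T : 'M[X -> Y]_(k, m)) :
  opmul (const_mx 0) T = 0 :> 'M[X -> Z]_(n, m).
Proof.
apply/matrixP => i j; rewrite !mxE; apply/funext => x.
by rewrite big1// => l _; rewrite mxE.
Qed.

Lemma opmul0r (X : Type) (Y Z : normedModType C) n k m (S : 'M[Y -> Z]_(n, k)) :
  bounded_mx S -> opmul S (const_mx 0) = 0 :> 'M[X -> Z]_(n, m).
Proof.
move=> Sb; apply/matrixP => i j; rewrite !mxE; apply/funext => x.
by rewrite big1// => l _; rewrite mxE (bounded_op0 (Sb _ _)).
Qed.

Lemma fct_mxE (X : Type) (Y : lmodType C) n m (c : C) (S T : 'M[X -> Y]_(n, m))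
    i j x : (map_mx ( *:%R c) S + T) i j x = c *: S i j x + T i j x.
Proof. by rewrite !mxE. Qed.

Lemma lscalemx_app (X : Type) (Y : lmodType C) n k m (alpha : 'M[C]_(n, k))
    (T : 'M[X -> Y]_(k, m)) i j x :
  lscalemx alpha T i j x = \sum_l alpha i l *: T l j x.
Proof. by rewrite mxE fct_sumE. Qed.

Lemma rscalemx_app (X : Type) (Y : lmodType C) n k m (T : 'M[X -> Y]_(n, k))
    (beta : 'M[C]_(k, m)) i j x :
  rscalemx T beta i j x = \sum_l beta l j *: T i l x.
Proof. by rewrite mxE fct_sumE. Qed.

Lemma opmul_lscalel (X Y : Type) (Z : lmodType C) n' n k m
    (alpha : 'M[C]_(n', n)) (S : 'M[Y -> Z]_(n, k)) (T : 'M[X -> Y]_(k, m)) :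
  opmul (lscalemx alpha S) T = lscalemx alpha (opmul S T).
Proof.
apply/matrixP => i j; apply/funext => x; rewrite lscalemx_app mxE.
under eq_bigr => l _ do rewrite lscalemx_app.
rewrite exchange_big/=; apply: eq_bigr => l _.
by rewrite mxE scaler_sumr.
Qed.

Lemma opmul_rscaler (X : Type) (Y Z : normedModType C) n k m m'
    (S : 'M[Y -> Z]_(n, k)) (T : 'M[X -> Y]_(k, m)) (beta : 'M[C]_(m, m')) :
  bounded_mx S -> opmul S (rscalemx T beta) = rscalemx (opmul S T) beta.
Proof.
move=> Sb; apply/matrixP => i j; apply/funext => x; rewrite rscalemx_app mxE.
transitivity (\sum_l \sum_r beta r j *: S i l (T l r x)).
  apply: eq_bigr => l _; rewrite rscalemx_app (bounded_op_sum (Sb _ _)).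
  by apply: eq_bigr => r _; rewrite (bounded_opZ (Sb _ _)).
rewrite exchange_big/=; apply: eq_bigr => r _.
by rewrite mxE scaler_sumr.
Qed.

(** A scalar matrix passes from one factor to the next because the entries of S are linear. *)
Lemma opmul_rscale_lscale (X : Type) (Y Z : normedModType C) n k k' m
    (S : 'M[Y -> Z]_(n, k)) (alpha : 'M[C]_(k, k')) (T : 'M[X -> Y]_(k', m)) :
  bounded_mx S -> opmul (rscalemx S alpha) T = opmul S (lscalemx alpha T).
Proof.
move=> Sb; apply/matrixP => i j; apply/funext => x; rewrite !mxE.
under eq_bigr => l _ do rewrite rscalemx_app.
rewrite exchange_big/=; apply: eq_bigr => r _.
rewrite lscalemx_app (bounded_op_sum (Sb _ _)).
by apply: eq_bigr => l _; rewrite (bounded_opZ (Sb _ _)).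
Qed.

(** * Adjoints of matrices of operators *)

Section AdjointMatrices.
Variables X Y : hilbertType R.

Lemma bounded_mx_adjmx n m (T : 'M[X -> Y]_(n, m)) :
  bounded_mx T -> bounded_mx (adjmx T).
Proof. by move=> Tb i j; rewrite mxE; exact: bounded_op_adjoint. Qed.

Lemma innercol_opapp n m (T : 'M[X -> Y]_(n, m)) (u : 'cV[X]_m)
    (v : 'cV[Y]_n) : bounded_mx T ->
  innercol (opapp T u) v = innercol u (opapp (adjmx T) v).
Proof.
move=> Tb; rewrite /innercol.
transitivity (\sum_i \sum_j inner (T i j (u j 0)) (v i 0)).
  by apply: eq_bigr => i _; rewrite mxE linear_sumlz.
rewrite exchange_big/=; apply: eq_bigr => j _.
rewrite mxE linear_sumr/=; apply: eq_bigr => i _.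
by rewrite adjointP// mxE.
Qed.

Lemma innercol_ge0 n (u : 'cV[X]_n) : 0 <= innercol u u.
Proof. by apply: sumr_ge0 => i _; exact: dnorm_ge0. Qed.

Lemma adjmx_dirsum n m (S : 'M[X -> Y]_n) (T : 'M[X -> Y]_m) :
  adjmx (dirsum 0 S T) = dirsum 0 (adjmx S) (adjmx T).
Proof.
have adj0 : adjoint (0 : X -> Y) = 0.
  by apply: adjoint_unique => x y; rewrite linear0l linear0r.
apply/matrixP => i j; rewrite /dirsum.
by case: (split_ordP i) => {}i ->; case: (split_ordP j) => {}j ->; rewrite mxE
  ?block_mxEul ?block_mxEur ?block_mxEdl ?block_mxEdr ?mxE.
Qed.

Local Open Scope sesquilinear_scope.

(** Adjunction is conjugate linear and reverses products, hence the conjugate transpose on the other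
    side. *)
Lemma adjmx_lscale n' n m (beta : 'M[C]_(n', n)) (T : 'M[X -> Y]_(n, m)) :
  bounded_mx T ->
  adjmx (lscalemx beta T) = rscalemx (adjmx T) (beta ^t*).
Proof.
move=> Tb; apply/matrixP => i j; rewrite mxE.
apply: adjoint_unique => x y; rewrite lscalemx_app rscalemx_app.
rewrite linear_sumlz/= linear_sumr/=; apply: eq_bigr => l _.
by rewrite linearZl_LR linearZr_LR/= !mxE conjCK adjointP.
Qed.

Lemma adjmx_rscale n m m' (T : 'M[X -> Y]_(n, m)) (beta : 'M[C]_(m, m')) :
  bounded_mx T ->
  adjmx (rscalemx T beta) = lscalemx (beta ^t*) (adjmx T).
Proof.
move=> Tb; apply/matrixP => i j; rewrite mxE.
apply: adjoint_unique => x y; rewrite lscalemx_app rscalemx_app.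
rewrite linear_sumlz/= linear_sumr/=; apply: eq_bigr => l _.
by rewrite linearZl_LR linearZr_LR/= !mxE conjCK adjointP.
Qed.

End AdjointMatrices.
End BoundedOperators.

(** * The space of the functions f_h *)

Section StarRepresentations.
Variables (R : realType) (A : cstarAlgType R) (X : hilbertType R).
Variables (sigma : A -> X -> X).
Hypothesis rep : unital_star_rep sigma.
Local Notation C := R[i].

Lemma star_rep_bounded a : bounded_op (sigma a).
Proof. by have [] := rep. Qed.

Lemma star_repM a b x : sigma (a * b) x = sigma a (sigma b x).
Proof. by have [_ _ -> _ _] := rep. Qed.

(** Automatic continuity enters here. It makes the values of f_h bounded on the algebra; the
    linearity in a is what matrix products and scalings over A require. *)
Lemma star_rep_app_bounded x : bounded_op (fun a => sigma a x).
Proof.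
split; first by move=> c a b; have [_ -> _ _ _] := rep.
by exists (2 * `|x|) => a; rewrite mulrAC; exact: star_rep_bound.
Qed.

Lemma star_rep_star a x y :
  inner (sigma a x) y = inner x (sigma (star a) y).
Proof. by have [_ _ _ _ <-] := rep; rewrite starK. Qed.

Lemma bounded_mx_rep n m (P : 'M[A]_(n, m)) : bounded_mx (map_mx sigma P).
Proof. by move=> i j; rewrite mxE; exact: star_rep_bounded. Qed.

Lemma map_mx_repM n k m (P : 'M[A]_(n, k)) (Q : 'M[A]_(k, m)) :
  map_mx sigma (P *m Q) = opmul (map_mx sigma P) (map_mx sigma Q).
Proof.
apply/matrixP => i j; apply/funext => x; rewrite !mxE.
rewrite (bounded_op_sum (star_rep_app_bounded x)).
by apply: eq_bigr => l _; rewrite !mxE star_repM.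
Qed.

Lemma adjmx_rep n m (P : 'M[A]_(n, m)) :
  adjmx (map_mx sigma P) = map_mx sigma (starmx P).
Proof.
apply/matrixP => i j; rewrite !mxE.
by apply: adjoint_unique => x y; exact: star_rep_star.
Qed.

Lemma map_mx_rep_lscale n' n m (alpha : 'M[C]_(n', n)) (P : 'M[A]_(n, m)) :
  map_mx sigma (lscalemx alpha P) = lscalemx alpha (map_mx sigma P).
Proof.
apply/matrixP => i j; apply/funext => x; rewrite lscalemx_app !mxE.
rewrite (bounded_op_sum (star_rep_app_bounded x)).
by apply: eq_bigr => l _; rewrite mxE (bounded_opZ (star_rep_app_bounded x)).
Qed.

Lemma map_mx_rep_rscale n m m' (P : 'M[A]_(n, m)) (beta : 'M[C]_(m, m')) :
  map_mx sigma (rscalemx P beta) = rscalemx (map_mx sigma P) beta.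
Proof.
apply/matrixP => i j; apply/funext => x; rewrite rscalemx_app !mxE.
rewrite (bounded_op_sum (star_rep_app_bounded x)).
by apply: eq_bigr => l _; rewrite mxE (bounded_opZ (star_rep_app_bounded x)).
Qed.

Lemma opapp_rep_scalar (a : A) (x : X) :
  opapp (map_mx sigma a%:M) (const_mx x : 'cV_1) = const_mx (sigma a x).
Proof. by apply/matrixP => i j; rewrite !mxE big_ord1 !mxE !ord1 eqxx. Qed.

End StarRepresentations.

Lemma starmxK (R : realType) (A : cstarAlgType R) n m (P : 'M[A]_(n, m)) :
  starmx (starmx P) = P.
Proof. by apply/matrixP => i j; rewrite !mxE starK. Qed.

(** * The kernel K, the functions f_h and their Hilbert space *)

Section Lift.
Variables (R : realType) (A : cstarAlgType R) (X Y : hilbertType R).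
Variables (sigma : A -> X -> X) (rep : unital_star_rep sigma).
Variables (S : Type) (Omega : ncset S) (H : ncfun Omega X Y).
Arguments Omega : clear implicits.
Hypothesis Hb : op_valued H.
Local Notation C := R[i].
Local Notation K := (lift_kernel sigma H).

Let bmxH n (Z : Omega n) : bounded_mx (H Z) := @Hb n Z.

Lemma bounded_mx_lift_kernel n m (Z : Omega n) (W : Omega m) P :
  bounded_mx (K Z W P).
Proof.
apply: bounded_mx_opmul; last exact/bounded_mx_adjmx/bmxH.
by apply: bounded_mx_opmul; [exact: bmxH|exact: bounded_mx_rep].
Qed.

Lemma lift_kernelE n m (Z : Omega n) (W : Omega m) P i j y :
  K Z W P i j y =
  \sum_l \sum_k H Z i k (sigma (P k l) (adjmx (H W) l j y)).
Proof.
rewrite mxE; apply: eq_bigr => l _; rewrite mxE.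
by apply: eq_bigr => k _; rewrite mxE.
Qed.

Lemma graded_lift_kernel : graded_kernel K.
Proof.
move=> n m Z W; split.
- by move=> P; exact: bounded_mx_lift_kernel.
- move=> c P Q; apply/matrixP => i j; apply/funext => y.
  rewrite fct_mxE !lift_kernelE scaler_sumr -big_split/=.
  apply: eq_bigr => l _; rewrite scaler_sumr -big_split/=.
  apply: eq_bigr => k _; rewrite !mxE.
  have [_ -> _ _ _] := rep.
  by rewrite (bounded_opD (bmxH _ _ _)) (bounded_opZ (bmxH _ _ _)).
have [c c0 cP] := bounded_mx_bound (bmxH Z).
have [d d0 dP] := bounded_mx_bound (bounded_mx_adjmx (bmxH W)).
(* c bounds the entries of H(Z), d those of the adjoint of H(W), and 2 comes from
   [star_rep_bound]. *)
exists (c * 2 * d) => P i j y; rewrite lift_kernelE exchange_big/=.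
rewrite (le_trans (ler_norm_sum _ _ _))// mulr_sumr mulr_suml.
apply: ler_sum => k _; rewrite (le_trans (ler_norm_sum _ _ _))//.
rewrite mulr_sumr mulr_suml; apply: ler_sum => l _.
rewrite (le_trans (cP _ _ _))//.
have -> : c * 2 * d * `|P k l| * `|y| = c * (2 * `|P k l| * (d * `|y|)) by ring.
rewrite ler_wpM2l// (le_trans (star_rep_bound _ _ rep))//.
by rewrite ler_wpM2l// mulr_ge0.
Qed.

(** On direct sums both outer factors are block diagonal, so each block of P meets only its own pair
    of factors. *)
Lemma global_lift_kernel (z : S) : global_function z H -> global_kernel z K.
Proof.
move=> [_ Hsum]; split; first exact: graded_lift_kernel.
move=> n n' m m' Z Z' W W' ZZ' WW' ZE WE P11 P12 P21 P22.
rewrite /lift_kernel (Hsum _ _ _ _ _ ZE) (Hsum _ _ _ _ _ WE) adjmx_dirsum.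
rewrite map_block_mx /dirsum opmul_block !opmul0l ?addr0 ?add0r.
rewrite opmul_block !opmul0r ?addr0 ?add0r//.
all: by apply: bounded_mx_opmul; [exact: bmxH|exact: bounded_mx_rep].
Qed.

Lemma opapp_lift_kernel n m (Z : Omega n) (W : Omega m) P y :
  opapp (K Z W P) y =
  opapp (H Z) (opapp (map_mx sigma P) (opapp (adjmx (H W)) y)).
Proof.
rewrite opapp_opmul; last first.
  by apply: bounded_mx_opmul; [exact: bmxH|exact: bounded_mx_rep].
by rewrite opapp_opmul//; exact: bmxH.
Qed.

(** For P = Q^* Q the form <K(Z, Z)(P) y, y> equals <u, u> with u = (id (x) sigma)(Q) H(Z)^* y. *)
Lemma cp_lift_kernel : cp_kernel K.
Proof.
move=> n Z _ [Q ->] y; rewrite opapp_lift_kernel map_mx_repM//.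
rewrite opapp_opmul; last exact: bounded_mx_rep.
rewrite innercol_opapp; last exact: bmxH.
rewrite innercol_opapp; last exact: bounded_mx_rep.
by rewrite adjmx_rep// starmxK innercol_ge0.
Qed.

Lemma lift_funE h n (Z : Omega n) i j a :
  lift_fun sigma H h Z i j a = H Z i j (sigma a h).
Proof.
rewrite !mxE (bigD1 j)//= big1 ?addr0.
  by rewrite !mxE big_ord1 !mxE eqxx.
(* [mxop] evaluates at the column with a in place j and 0 elsewhere; the zeros contribute
   nothing. *)
move=> k kj; rewrite !mxE big_ord1 !mxE (negbTE kj).
rewrite (bounded_op0 (star_rep_app_bounded rep _)).
by rewrite (bounded_op0 (bmxH _ _ _)).
Qed.

Lemma opapp_lift_fun h n (Z : Omega n) (u : 'cV[A]_n) :
  opapp (lift_fun sigma H h Z) u =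
  opapp (H Z) (opapp (map_mx sigma u) (const_mx h : 'cV_1)).
Proof.
apply/matrixP => i j; rewrite !mxE; apply: eq_bigr => k _.
by rewrite lift_funE mxE big_ord1 !mxE.
Qed.

(** The row v produces a column of height one, whose entry is the h with K_{W,v,y} = f_h. *)
Definition kernel_vec m (W : Omega m) (v : 'rV[A]_m) (y : 'cV[Y]_m) : X :=
  opapp (map_mx sigma v) (opapp (adjmx (H W)) y) 0 0.

Lemma kernel_fun_lift m (W : Omega m) (v : 'rV[A]_m) (y : 'cV[Y]_m) :
  kernel_fun K W v y = lift_fun sigma H (kernel_vec W v y).
Proof.
apply: functional_extensionality_dep => n; apply/funext => Z.
congr (mxop _); apply/funext => u.
rewrite opapp_lift_kernel map_mx_repM// opapp_opmul; last exact: bounded_mx_rep.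
congr (opapp _ (opapp _ _)).
by apply/matrixP => i j; rewrite [RHS]mxE !ord1.
Qed.

(** The subspace N, written entrywise as an intersection of kernels of bounded operators; this makes
    it a closed subspace. *)
Definition lift_ker : set X :=
  [set h | forall n (Z : Omega n) i j a, H Z i j (sigma a h) = 0].

Let Hsigma_bounded n (Z : Omega n) i j a :
  bounded_op (fun h => H Z i j (sigma a h)).
Proof. by apply: bounded_op_comp; [exact: bmxH|exact: star_rep_bounded]. Qed.

Lemma subspace_lift_ker : subspace lift_ker.
Proof.
split=> [|c x y x0 y0] n Z i j a.
  exact: (subspace_ker (Hsigma_bounded Z i j a)).1.
by apply: (subspace_ker (Hsigma_bounded Z i j a)).2; [exact: x0|exact: y0].
Qed.

Lemma closed_lift_ker : closed lift_ker.
Proof.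
apply/closed_adherenceP => x xP n Z i j a.
move/closed_adherenceP: (closed_ker (Hsigma_bounded Z i j a)); apply.
by move=> e e0; have [y y0 xy] := xP e e0; exists y => //; exact: y0.
Qed.

(** The condition defining N ranges over all of A, so it absorbs the additional factor a. *)
Lemma lift_ker_rep a h : lift_ker h -> lift_ker (sigma a h).
Proof. by move=> h0 n Z i j b; rewrite -star_repM// h0. Qed.

Lemma lift_fun_eq h k :
  lift_fun sigma H h = lift_fun sigma H k <-> lift_ker (h - k).
Proof.
split=> [E n Z i j a|hk].
  by rewrite (bounded_opB (Hsigma_bounded _ _ _ _)) -!lift_funE E subrr.
apply: functional_extensionality_dep => n; apply/funext => Z.
apply/matrixP => i j; apply/funext => a; apply/eqP.
rewrite !lift_funE -subr_eq0 -(bounded_opB (Hsigma_bounded Z i j a)).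
by rewrite hk.
Qed.

(** A function f_h is represented by the one vector orthogonal to N that induces it. *)
Definition lift_ev (f : orthsp lift_ker) : ncfun Omega A Y :=
  lift_fun sigma H (val f).

(** Subtracting from h its projection onto N leaves f_h unchanged. *)
Lemma lift_ev_onto h : exists f, lift_ev f = lift_fun sigma H h.
Proof.
have [p p0 pP] := projection h subspace_lift_ker closed_lift_ker.
have hpN : h - p \in orthc lift_ker by apply/orthcP.
exists (Sub (h - p) hpN); apply/lift_fun_eq; rewrite SubK.
rewrite addrAC subrr add0r -scaleN1r -[_ *: p]addr0.
by apply: subspace_lift_ker.2 => //; exact: subspace_lift_ker.1.
Qed.

Lemma orthsp_inner_eq0 (f : orthsp lift_ker) h : lift_ker h ->
  inner (val f) h = 0.
Proof. by move=> h0; have /orthcP/(_ h h0) := valP f. Qed.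

(** The difference f - g lies in N and is orthogonal to N. *)
Lemma lift_ev_inj : injective lift_ev.
Proof.
move=> f g /lift_fun_eq fg; apply/eqP; rewrite -subr_eq0.
rewrite -(dnorm_eq0 inner); apply/eqP.
by rewrite inner_orthsp; apply: orthsp_inner_eq0; rewrite raddfB.
Qed.

Lemma range_lift_ev : range lift_ev = lift_space sigma H.
Proof.
apply/seteqP; split=> [_ [f _ <-]|_ [h ->]]; first by exists (val f).
by have [f fE] := lift_ev_onto h; exists f.
Qed.

(** If h induces the same function, then f - h lies in N, and Pythagoras gives |h|^2 = |f|^2 + |f -
    h|^2. *)
Lemma norm_lift_ev (f : orthsp lift_ker) :
  is_min [set `|h| ^+ 2 | h in [set h | lift_ev f = lift_fun sigma H h]]
         (`|f| ^+ 2).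
Proof.
split; first by exists (val f).
move=> _ [h /lift_fun_eq fh <-].
have := dnormB inner (val f) (val f - h).
rewrite /= subKr (orthsp_inner_eq0 f fh) conjC0 addr0 subr0.
rewrite -!sqr_norm_inner => ->.
by rewrite norm_orthsp lerDl exprn_ge0.
Qed.

Lemma function_space_lift_ev : function_space lift_ev.
Proof.
split; first exact: lift_ev_inj.
move=> c f g n Z; apply/matrixP => i j; apply/funext => a.
rewrite fct_mxE !lift_funE linearP/=.
rewrite (bounded_opD (Hsigma_bounded _ _ _ _)).
by rewrite (bounded_opZ (Hsigma_bounded _ _ _ _)).
Qed.

Lemma global_lift_fun (z : S) h : global_function z H ->
  global_function z (lift_fun sigma H h).
Proof.
move=> [_ Hsum]; split=> [n Z i j|n m Z W U UE].
  have -> : lift_fun sigma H h Z i j = (fun a => H Z i j (sigma a h)).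
    by apply/funext => a; exact: lift_funE.
  by apply: bounded_op_comp; [exact: bmxH|exact: star_rep_app_bounded].
(* f_h arises from H entry by entry through a map sending 0 to 0, so direct sums are preserved. *)
have E k (V : Omega k) : lift_fun sigma H h V =
    map_mx (fun T a => T (sigma a h)) (H V).
  by apply/matrixP => i j; apply/funext => a; rewrite lift_funE mxE.
by rewrite !E (Hsum _ _ _ _ _ UE) map_block_mx !map_const_mx.
Qed.

(** Moving both operators across gives the inner product of f with [kernel_vec W v y]; k differs
    from that vector by an element of N, to which f is orthogonal. *)
Lemma lift_ev_reproducing m (W : Omega m) (v : 'rV[A]_m) (y : 'cV[Y]_m)
    (f k : orthsp lift_ker) : lift_ev k = kernel_fun K W v y ->
  innercol (opapp (lift_ev f W) (starmx v)) y = inner f k.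
Proof.
rewrite kernel_fun_lift => /lift_fun_eq kP.
rewrite opapp_lift_fun innercol_opapp; last exact: bmxH.
rewrite innercol_opapp; last exact: bounded_mx_rep.
rewrite adjmx_rep// starmxK /innercol big_ord1 mxE inner_orthsp.
apply/esym/eqP; rewrite -subr_eq0 -linearBr.
by apply/eqP; exact: orthsp_inner_eq0 kP.
Qed.

(** N is invariant under sigma(star a), hence its complement under sigma(a). *)
Fact orthc_rep a (f : orthsp lift_ker) : sigma a (val f) \in orthc lift_ker.
Proof.
apply/orthcP => h h0; rewrite star_rep_star//.
exact/orthsp_inner_eq0/lift_ker_rep.
Qed.

Definition orthsp_rep a (f : orthsp lift_ker) : orthsp lift_ker :=
  Sub (sigma a (val f)) (orthc_rep a f).

Lemma orthsp_rep_unital : unital_star_rep orthsp_rep.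
Proof.
have [sb sL sM s1 sS] := rep; split.
- move=> a; split.
    move=> c f g; apply: val_inj.
    by rewrite /= (bounded_opD (sb a)) (bounded_opZ (sb a)).
  by have [c cP] := (sb a).2; exists c => f; exact: cP.
- by move=> c a b; apply/funext => f; apply: val_inj; rewrite /= sL.
- by move=> a b; apply/funext => f; apply: val_inj; rewrite /= sM.
- by apply/funext => f; apply: val_inj; rewrite /= s1.
- by move=> a f g; exact: sS.
Qed.

Lemma opapp_lift_ev_rep a f m (W : Omega m) (v : 'rV[A]_m) :
  opapp (lift_ev (orthsp_rep a f) W) (starmx v) =
  opapp (lift_ev f W) (starmx v *m a%:M).
Proof.
rewrite !opapp_lift_fun map_mx_repM// opapp_opmul; last exact: bounded_mx_rep.
by rewrite opapp_rep_scalar.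
Qed.

Lemma kernel_vec_scale a m (W : Omega m) (v : 'rV[A]_m) (y : 'cV[Y]_m) :
  kernel_vec W (a *: v) y = sigma a (kernel_vec W v y).
Proof.
rewrite /kernel_vec !mxE (bounded_op_sum (star_rep_bounded rep a)).
by apply: eq_bigr => l _; rewrite !mxE star_repM.
Qed.

(** Both sides are compared modulo N, and sigma(a) respects congruence modulo N. *)
Lemma lift_ev_rep_kernel a m (W : Omega m) (v : 'rV[A]_m) (y : 'cV[Y]_m) k :
  lift_ev k = kernel_fun K W v y ->
  lift_ev (orthsp_rep a k) = kernel_fun K W (a *: v) y.
Proof.
rewrite !kernel_fun_lift kernel_vec_scale => /lift_fun_eq kP.
apply/lift_fun_eq; rewrite /= -(bounded_opB (star_rep_bounded rep a)).
exact: lift_ker_rep.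
Qed.

Lemma global_rkhs_lift_ev (z : S) : global_function z H ->
  global_rkhs z K lift_ev.
Proof.
move=> Hg; split.
- exact: function_space_lift_ev.
- by move=> f; exact: global_lift_fun.
- move=> m W v y; rewrite range_lift_ev kernel_fun_lift.
  by exists (kernel_vec W v y).
- exact: lift_ev_reproducing.
- exists orthsp_rep; split.
  + exact: orthsp_rep_unital.
  + by move=> a f m W v; exact: opapp_lift_ev_rep.
  + by move=> a f m W v y k; exact: lift_ev_rep_kernel.
Qed.

End Lift.

(** On the left, alpha H(Z) = H(Z') alpha carries alpha inward to P; on the right, the adjoint of
    beta H(W) = H(W') beta does the same for the conjugate transpose of beta. *)
Lemma nc_lift_kernel (R : realType) (A : cstarAlgType R) (X Y : hilbertType R)
    (sigma : A -> X -> X) (V : lmodType R[i]) (Omega : ncset V)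
    (H : ncfun Omega X Y) :
  unital_star_rep sigma -> nc_function H -> nc_kernel (lift_kernel sigma H).
Proof.
move=> rep [Hb Hnc]; split; first exact: graded_lift_kernel.
move=> n n' m m' Z Z' W W' alpha beta ZE WE P.
have bH k (U : Omega k) : bounded_mx (H k U) by exact: Hb.
rewrite /lift_kernel map_mx_rep_rscale// map_mx_rep_lscale//.
rewrite -!opmul_lscalel (Hnc _ _ _ _ _ ZE) opmul_rscale_lscale; last exact: bH.
rewrite -opmul_rscaler; last first.
  apply: bounded_mx_opmul; first exact: bH.
  by rewrite -map_mx_rep_lscale//; exact: bounded_mx_rep.
(* The right factor is read as the adjoint of beta H(W), to which the intertwining property of H
   applies. *)
rewrite -adjmx_lscale; last exact: bH.
rewrite (Hnc _ _ _ _ _ WE) adjmx_rscale; last exact: bH.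
rewrite -(opmul_rscale_lscale _ (adjmx (H m' W'))); last first.
  apply: bounded_mx_opmul; first exact: bH.
  by rewrite -map_mx_rep_lscale//; exact: bounded_mx_rep.
by rewrite opmul_rscaler//; exact: bH.
Qed.

Theorem theorem3p7 (R : realType) (A : cstarAlgType R) (X Y : hilbertType R)
    (sigma : A -> X -> X) (sigma_rep : unital_star_rep sigma) :
  (forall (S : Type) (z : S) (Omega : ncset S) (H : ncfun Omega X Y),
     is_ncset z Omega ->
     global_function z H ->
     let K := lift_kernel sigma H in
     global_kernel z K /\ cp_kernel K /\
     exists (F : hilbertType R) (ev : F -> ncfun Omega A Y),
       [/\ range ev = lift_space sigma H,
           forall f : F,
             is_min [set `|h| ^+ 2 | h in [set h | ev f = lift_fun sigma H h]]
                    (`|f| ^+ 2)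
         & global_rkhs z K ev]) /\
  (forall (V : lmodType R[i]) (Omega : ncset V) (H : ncfun Omega X Y),
     is_ncset 0 Omega ->
     nc_function H ->
     let K := lift_kernel sigma H in
     nc_kernel K /\ cp_kernel K).
Proof.
split=> [S z Omega H _ Hg K|V Omega H _ Hnc K]; last first.
  by split; [exact: nc_lift_kernel|apply: cp_lift_kernel => //; case: Hnc].
have Hb := Hg.1; split; first exact: global_lift_kernel.
split; first exact: cp_lift_kernel.
(* The Hilbert space is the orthogonal complement of N with the inner product of X. *)
exists (orthsp (lift_ker sigma H)), (@lift_ev _ _ _ _ sigma _ _ H); split.
- exact: range_lift_ev.
- exact: norm_lift_ev.
- exact: global_rkhs_lift_ev.
Qed.
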